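(* The regular octahedron in its standard position in $\mathbb{R}^3$ can be decomposed into four tetrahedra with orthogonally connected boundaries.
   Context: A polygonal path in $\mathbb{R}^3$ is orthogonal if each of its edges is parallel to one of the coordinate axes. A set $S\subset\mathbb{R}^3$ is orthogonally connected if any two distinct points of $S$ are joined by an orthogonal path contained in $S$. A polytope is decomposed into polytopes $P_1,\dots,P_k$ if it is their union and their interiors are pairwise disjoint. Standard position of the regular octahedron: one of its three diagonals is parallel to the $z$-axis, and the square formed by the four remaining vertices has its sides parallel to the $x$-axis and the $y$-axis. For example, the convex hull of $(\pm1,\pm1,0)$ and $(0,0,\pm\sqrt2)$. *)

(* Defs.v *)
From HB Require Import structures.
From mathcomp Require Import all_boot all_order all_algebra.
From mathcomp Require Import all_classical all_reals all_analysis.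

Set Implicit Arguments.
Unset Strict Implicit.
Unset Printing Implicit Defensive.

Import Order.TTheory GRing.Theory Num.Theory.
Import numFieldNormedType.Exports.

Local Open Scope classical_set_scope.
Local Open Scope ring_scope.

Definition x_axis : 'I_3 := Ordinal (isT : 0 < 3)%N.
Definition y_axis : 'I_3 := Ordinal (isT : 1 < 3)%N.
Definition z_axis : 'I_3 := Ordinal (isT : 2 < 3)%N.

Section Definitions.
Context {R : realType}.
Implicit Types (u v a b c : 'rV[R]_3) (S P : set 'rV[R]_3).

Definition parallel_to (k : 'I_3) u : Prop :=
  exists2 t : R, t != 0 & u = t *: delta_mx 0 k.

Definition dot u v : R := (u *m v^T) 0 0.

Definition convex_hull (I : finType) (p : I -> 'rV[R]_3) : set 'rV[R]_3 :=
  [set x | exists w : I -> R,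
    [/\ forall i, 0 <= w i, \sum_i w i = 1 & x = \sum_i w i *: p i]].

Definition segment a b : set 'rV[R]_3 :=
  [set x | exists t : R, 0 <= t <= 1 /\ x = (1 - t) *: a + t *: b].

(* The topology on 'rV[R]_3 comes from the sup norm, which is equivalent to
   the Euclidean one. *)
Definition boundary S : set 'rV[R]_3 := closure S `\` interior S.

(* The polygonal path with n edges and successive vertices p 0, ..., p n;
   the values of p beyond n are irrelevant. *)
Definition orthogonal_path (n : nat) (p : nat -> 'rV[R]_3) : Prop :=
  forall i, (i < n)%N -> exists k : 'I_3, parallel_to k (p i.+1 - p i).

Definition path_support (n : nat) (p : nat -> 'rV[R]_3) : set 'rV[R]_3 :=
  \bigcup_(i in `I_n) segment (p i) (p i.+1).

Definition orthogonally_connected S : Prop :=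
  forall x y, S x -> S y -> x != y ->
    exists (n : nat) (p : nat -> 'rV[R]_3),
      [/\ p 0%N = x, p n = y, orthogonal_path n p & path_support n p `<=` S].

Definition tetrahedron P : Prop :=
  exists p : 'I_4 -> 'rV[R]_3,
    row_free (\matrix_(i < 3) (p (lift ord0 i) - p ord0)) /\
    P = convex_hull p.

Definition decomposed_into P (k : nat) (T : 'I_k -> set 'rV[R]_3) : Prop :=
  P = \bigcup_(i in [set: 'I_k]) T i /\
  forall i j, i != j -> interior (T i) `&` interior (T j) = set0.

(* An octahedron is given by its centre c and its half-diagonals d 0, d 1, d 2:
   its vertices are the six points c + d i and c - d i. *)
Definition octahedron c (d : 'I_3 -> 'rV[R]_3) : set 'rV[R]_3 :=
  convex_hull (fun ib : 'I_3 * bool => c + (-1) ^+ ib.2 *: d ib.1).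

Definition regular_half_diagonals (d : 'I_3 -> 'rV[R]_3) : Prop :=
  [/\ forall i, d i != 0,
      forall i j, dot (d i) (d i) = dot (d j) (d j) &
      forall i j, i != j -> dot (d i) (d j) = 0].

(* The sides of the square spanned by the diagonals i and j are the vectors
   (c +- d j) - (c +- d i). *)
Definition standard_position (d : 'I_3 -> 'rV[R]_3) : Prop :=
  exists k : 'I_3, parallel_to z_axis (d k) /\
    forall i j, i != k -> j != k -> i != j -> forall s s' : bool,
      let side := (-1) ^+ s *: d j - (-1) ^+ s' *: d i in
      parallel_to x_axis side \/ parallel_to y_axis side.

End Definitions.

(* Main.v *)
From Stdlib Require Import Relation_Operators Operators_Properties.
Require Import Defs.
From mathcomp Require Import all_boot all_order all_algebra.
From mathcomp Require Import all_classical all_reals all_analysis.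
From mathcomp Require Import perm ring lra.
Import Order.TTheory GRing.Theory Num.Theory.
Import numFieldNormedType.Exports.
Local Open Scope classical_set_scope.
Local Open Scope ring_scope.

Set Implicit Arguments.
Unset Strict Implicit.
Unset Printing Implicit Defensive.

(** Call d_k the vertical half-diagonal and d_i, d_j the horizontal ones.  Since
    the sides of the horizontal square are parallel to axes, so are the two
    vectors d_j - d_i and d_j + d_i, and so is d_k.  Cut the octahedron by the
    horizontal plane and by the vertical plane through c, c + d_i and c + d_k.
    The four pieces are the tetrahedra with vertices c + d_i, c - d_i,
    c + s d_j, c + s' d_k for two signs s, s'; all share the edge from c - d_i
    to c + d_i, a horizontal diagonal.  (Sharing the vertical diagonal instead
    would fail: the two faces at that edge lie in vertical planes oblique to the
    other axes, whose only axis direction is that of the edge, so the edge would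
    be a component of its own.)

    Write e = (d_i, s d_j, s' d_k) and use coordinates (a, b, g) relative to c
    and e.  The piece is b >= 0, g >= 0, |a| + b + g <= 1, and each of its faces
    contains an axis direction: e_1 - e_0 or e_1 + e_0 in the two outer faces,
    both of them in the bottom face g = 0, and e_2 in the face b = 0.  From
    an outer or bottom face, slide along such a direction until b = 0, without
    leaving the face; then descend along e_2 to the shared edge; the bottom face
    finally allows an L-shaped path from there to c
    ([quarter_boundary_connected]).  So the boundary is connected through the
    hub c.

    For the metric side, the coordinates are computed by dot products with the
    orthogonal frame, the pieces are the sets where four affine barycentric
    coordinates are nonnegative ([quarter_hullE]), and interior and boundary of
    such a set are read off from the signs ([interior_polyhedron],
    [boundary_polyhedron]).  The octahedron lies in the unit ball of the l1 norm
    of the coordinates ([octahedron_norm1]), so the signs of the coordinates of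
    a point tell which piece contains it, while b and g are positive
    at the interior points of a piece, whence disjoint interiors. *)

(** * Finite index types *)

Lemma forall_I4 (P : 'I_4 -> Prop) :
  P (Ordinal (isT : 0 < 4)%N) -> P (Ordinal (isT : 1 < 4)%N) ->
  P (Ordinal (isT : 2 < 4)%N) -> P (Ordinal (isT : 3 < 4)%N) -> forall i, P i.
Proof.
move=> p0 p1 p2 p3 [[|[|[|[|//]]]] i4].
- by rewrite (_ : Ordinal _ = Ordinal (isT : 0 < 4)%N) //; exact: val_inj.
- by rewrite (_ : Ordinal _ = Ordinal (isT : 1 < 4)%N) //; exact: val_inj.
- by rewrite (_ : Ordinal _ = Ordinal (isT : 2 < 4)%N) //; exact: val_inj.
- by rewrite (_ : Ordinal _ = Ordinal (isT : 3 < 4)%N) //; exact: val_inj.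
Qed.

Lemma sum_I4 (V : nmodType) (F : 'I_4 -> V) : \sum_i F i =
  F (Ordinal (isT : 0 < 4)%N) + F (Ordinal (isT : 1 < 4)%N) +
  F (Ordinal (isT : 2 < 4)%N) + F (Ordinal (isT : 3 < 4)%N).
Proof.
rewrite !big_ord_recr big_ord0 /= add0r.
by congr (F _ + F _ + F _ + F _); exact: val_inj.
Qed.

Lemma sum_I3 (V : nmodType) (F : 'I_3 -> V) :
  \sum_i F i = F x_axis + F y_axis + F z_axis.
Proof.
rewrite !big_ord_recr big_ord0 /= add0r.
by congr (F _ + F _ + F _); exact: val_inj.
Qed.

(** * Affine functions and polyhedra *)

Definition affine {R : realType} (f : 'rV[R]_3 -> R) :=
  forall t a b, f ((1 - t) *: a + t *: b) = (1 - t) * f a + t * f b.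

(** An affine function on the space is its value at the origin plus a linear
    combination of the three coordinates. *)
Lemma affine_continuous {R : realType} (f : 'rV[R]_3 -> R) :
  affine f -> continuous f.
Proof.
move=> aff; pose g x := f x - f 0.
have gZ t x : g (t *: x) = t * g x.
  by have := aff t 0 x; rewrite scaler0 add0r /g => ->; ring.
have gD x y : g (x + y) = g x + g y.
  have -> : x + y = 2 *: ((1 - 2^-1) *: x + 2^-1 *: y).
    by apply/rowP => i; rewrite !mxE; field.
  by rewrite gZ /g aff; field.
pose v i := g (delta_mx 0 i).
have -> : f = fun x => f 0 +
    (x 0 x_axis * v x_axis + x 0 y_axis * v y_axis + x 0 z_axis * v z_axis).
  apply/funext => x; rewrite -[LHS](subrKC (f 0)) -/(g x); congr (_ + _).
  rewrite {1}(row_sum_delta x) !big_ord_recr big_ord0 /= add0r !gD !gZ.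
  by congr (x 0 _ * v _ + x 0 _ * v _ + x 0 _ * v _); exact: val_inj.
have cM (i : 'I_3) : continuous (fun x : 'rV[R]_3 => x 0 i * v i).
  by move=> x; exact: (cvgM (@coord_continuous R 1 3 0 i x) (cvg_cst _)).
move=> x.
exact: (cvgD (cvg_cst _) (cvgD (cvgD (cM x_axis x) (cM y_axis x)) (cM z_axis x))).
Qed.

Section Polyhedra.
Context {R : realType} {J : finType} {f : J -> 'rV[R]_3 -> R}.
Hypothesis f_affine : forall j, affine (f j).
Hypothesis f_pos : forall j, exists y, 0 < f j y.

(** An interior point x has no vanishing f j: on the line from a point y with
    f j y > 0 through x, the function f j is negative just beyond x. *)
Lemma interior_polyhedron :
  interior [set x | forall j, 0 <= f j x] = [set x | forall j, 0 < f j x].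
Proof.
apply/seteqP; split => x /=; last first.
  move=> fx; rewrite /interior /=.
  have : \forall y \near x, forall j, 0 < f j y.
    apply: (@filter_forall _ _ _ (nbhs x)) => j.
    exact: (affine_continuous (f_affine j) (open_nbhs_nbhs (conj (@open_gt R 0) (fx j)))).
  by apply: filterS => y fy j; exact: ltW.
move=> Tx j; rewrite lt_def (interior_subset Tx j) andbT.
apply/eqP => fjx; have [y fjy] := f_pos j.
pose g t := (1 - t) *: x + t *: y.
have g0 : g 0 = x by rewrite /g subr0 scale1r scale0r addr0.
have gc : {for (0 : R), continuous g}.
  apply: cvgD; apply: cvgZ; try exact: cvg_cst; last exact: cvg_id.
  by apply: cvgB; [exact: cvg_cst | exact: cvg_id].
have : nbhs (0 : R) (g @^-1` [set x | forall j, 0 <= f j x]).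
  by apply: gc; rewrite g0.
move=> /nbhs_ballP [e /= e0 /(_ (- (e / 2)))].
(* The parameter - e / 2 lies beyond x, on the side away from y. *)
have be : ball (0 : R) e (- (e / 2)).
  by rewrite /ball /= sub0r opprK ger0_norm; lra.
by move=> /(_ be j); rewrite /g f_affine fjx; nra.
Qed.

Lemma boundary_polyhedron : boundary [set x | forall j, 0 <= f j x] =
  [set x | (forall j, 0 <= f j x) /\ exists j, f j x = 0].
Proof.
rewrite /boundary interior_polyhedron -(proj1 (closure_id _)); last first.
  rewrite (_ : [set _ | _] = \bigcap_j (f j @^-1` [set t | 0 <= t])).
    apply: closed_bigI => j _; apply: preimage_closed; last exact: closed_ge.
    by move=> x _; exact/affine_continuous.
  by apply/seteqP; split=> x /= fx j; [move=> _|]; exact: fx.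
apply/seteqP; split=> x /= [fx]; last by move=> [j fj]; split=> // /(_ j); rewrite fj ltxx.
move=> nfx; split=> //; apply: contrapT => nz; apply: nfx => j.
by rewrite lt_def fx andbT; apply/eqP => fj; apply: nz; exists j.
Qed.

End Polyhedra.

(** * Axis-parallel paths *)

Section Paths.
Context {R : realType}.
Implicit Types (S : set 'rV[R]_3) (x y v : 'rV[R]_3).

Definition axis_edge S x y :=
  (exists k, parallel_to k (y - x)) /\ segment x y `<=` S.

(** Closing the relation under symmetry and transitivity spares concatenating
    and reversing vertex sequences: [axis_joined_path] builds the sequence by
    adding one vertex in front at each step. *)
Definition axis_joined S := clos_refl_sym_trans _ (axis_edge S).

Lemma axis_edge_sym S x y : axis_edge S x y -> axis_edge S y x.
Proof.
move=> [[k [r r0 xy]] sS]; split.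
  by exists k; exists (- r); rewrite ?oppr_eq0 // scaleNr -xy opprB.
move=> _ [t [/andP[t0 t1] ->]]; apply: sS; exists (1 - t); split; first lra.
by rewrite subKr addrC.
Qed.

Lemma axis_joined_path S x y : axis_joined S x y -> exists n p,
  [/\ p 0%N = x, p n = y, orthogonal_path n p & path_support n p `<=` S].
Proof.
move=> xy; elim: {x y xy}(clos_rst_rst1n _ _ _ _ xy) => [x|x y z xy _ [n [p [p0 pn op sp]]]].
  by exists 0%N, (fun=> x); split=> // u [].
have {xy} [xy sxy] : axis_edge S x y by case: xy => // /axis_edge_sym.
exists n.+1, (fun i => if i is i'.+1 then p i' else x); split=> //.
  by move=> [|i] //= ni; [rewrite p0 | exact: op].
by move=> u [[|i] /= ni]; [rewrite p0; exact: sxy | move=> ?; apply: sp; exists i].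
Qed.

Lemma orthogonally_connected_hub S c :
  (forall x, S x -> axis_joined S x c) -> orthogonally_connected S.
Proof.
move=> hub x y /hub xc /hub yc _; apply: axis_joined_path.
exact: rst_trans xc (rst_sym _ _ _ _ yc).
Qed.

(** The case t = 0 is what lets later moves have any length: no edge of the
    path is then needed, whereas an edge has to be nonzero. *)
Lemma axis_joined_segment S x t v k : parallel_to k v ->
  segment x (x + t *: v) `<=` S -> axis_joined S x (x + t *: v).
Proof.
move=> [r r0 ->] sS; have [t0|t0] := eqVneq t 0.
  by rewrite t0 scale0r addr0; exact: rst_refl.
apply: rst_step; split=> //; exists k; exists (t * r); first by rewrite mulf_neq0.
by rewrite addrC addKr scalerA.
Qed.

End Paths.

(** The main move: a face is convex, so a segment with both ends in the face j
    stays in the boundary. *)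
Lemma axis_joined_face {R : realType} {J : finType} {f : J -> 'rV[R]_3 -> R}
    j k x t v : (forall i, affine (f i)) -> parallel_to k v ->
  (forall i, 0 <= f i x) -> (forall i, 0 <= f i (x + t *: v)) ->
  f j x = 0 -> f j (x + t *: v) = 0 ->
  axis_joined [set y | (forall i, 0 <= f i y) /\ exists i, f i y = 0]
    x (x + t *: v).
Proof.
move=> aff kv fx fy jx jy; apply: axis_joined_segment kv _.
move=> _ [r [/andP[r0 r1] ->]]; split=> [i|].
  by rewrite aff addr_ge0 // mulr_ge0 // subr_ge0.
by exists j; rewrite aff jx jy !mulr0 addr0.
Qed.

(** * Convex hulls and orthogonal frames *)

(** The weight of a point of the larger family collects those of its
    preimages. *)
Lemma convex_hull_comp {R : realType} {I J : finType} (g : I -> J) (p : J -> 'rV[R]_3) :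
  convex_hull (p \o g) `<=` convex_hull p.
Proof.
move=> _ [w [w0 w1 ->]]; exists (fun j => \sum_(i | g i == j) w i); split.
- by move=> j; apply: sumr_ge0.
- by rewrite -w1 [RHS](partition_big g xpredT).
rewrite (partition_big g xpredT) //=; apply: eq_bigr => j _.
by rewrite scaler_suml; apply: eq_bigr => i /eqP ->.
Qed.

Section Frames.
Context {R : realType}.
Implicit Types (u v x : 'rV[R]_3) (d e : 'I_3 -> 'rV[R]_3).

Lemma dotE u v : dot u v = \sum_i u 0 i * v 0 i.
Proof. by rewrite /dot mxE; apply: eq_bigr => i _; rewrite mxE. Qed.

Lemma dotDl u v x : dot (u + v) x = dot u x + dot v x.
Proof. by rewrite /dot mulmxDl mxE. Qed.

Lemma dotZl t u x : dot (t *: u) x = t * dot u x.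
Proof. by rewrite /dot -scalemxAl mxE. Qed.

Lemma dotZr t u x : dot u (t *: x) = t * dot u x.
Proof. by rewrite /dot linearZ /= -scalemxAr mxE. Qed.

Lemma dot_gt0 v : v != 0 -> 0 < dot v v.
Proof.
move=> v0; rewrite lt_def dotE sumr_ge0 ?andbT => [|i _]; last exact: sqr_ge0.
apply: contra v0; rewrite psumr_eq0 => [/allP v0|i _]; last exact: sqr_ge0.
apply/eqP/rowP => i; rewrite mxE; apply/eqP.
by have := v0 i (mem_index_enum i); rewrite /= mulf_eq0 orbb.
Qed.

Definition fcoord e l x := dot x (e l) / dot (e l) (e l).

Lemma fcoordD e l x y : fcoord e l (x + y) = fcoord e l x + fcoord e l y.
Proof. by rewrite /fcoord dotDl mulrDl. Qed.

Lemma fcoordZ e l t x : fcoord e l (t *: x) = t * fcoord e l x.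
Proof. by rewrite /fcoord dotZl mulrA. Qed.

Section Regular.
Variable e : 'I_3 -> 'rV[R]_3.
Hypothesis ereg : regular_half_diagonals e.

Lemma fcoord_frame l l' : fcoord e l (e l') = (l' == l)%:R.
Proof.
have [e0 _ eo] := ereg; rewrite /fcoord; case: (eqVneq l' l) => [->|ne].
  by rewrite divff // gt_eqF // dot_gt0.
by rewrite eo ?mul0r.
Qed.

(** A matrix E whose rows are orthogonal of equal norm r satisfies
    E * E^T = r, hence also E^T * E = r, which is the expansion. *)
Lemma fcoord_expansion x : x = \sum_l fcoord e l x *: e l.
Proof.
have [e0 er eo] := ereg; pose r := dot (e 0) (e 0); pose E := \matrix_l e l.
have r0 : r != 0 by rewrite gt_eqF // dot_gt0.
have EE : E *m (r^-1 *: E^T) = 1%:M.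
  apply/matrixP => i j; rewrite -scalemxAr !mxE.
  rewrite (_ : \sum_k _ = dot (e i) (e j)); last first.
    by rewrite dotE; apply: eq_bigr => k _; rewrite !mxE.
  case: (eqVneq i j) => [->|ne]; last by rewrite eo ?mulr0.
  by rewrite (er j 0) mulVf.
rewrite -{1}[x]mulmx1 -(mulmx1C EE) mulmxA mulmx_sum_row.
apply: eq_bigr => l _; rewrite rowK; congr (_ *: _).
rewrite -scalemxAr mxE mulrC /fcoord (er l 0); congr (_ * _).
by rewrite mxE dotE; apply: eq_bigr => k _; rewrite !mxE.
Qed.

(** Every vertex has l1 norm 1 in the coordinates of the frame. *)
Lemma octahedron_norm1 c x : octahedron c e x -> \sum_l `|fcoord e l (x - c)| <= 1.
Proof.
move=> [w [w0 w1 xE]].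
have cE l : fcoord e l (x - c) = \sum_ib w ib * (-1) ^+ ib.2 * (ib.1 == l)%:R.
  have -> : x - c = \sum_ib w ib *: ((-1) ^+ ib.2 *: e ib.1).
    rewrite xE; under eq_bigr do rewrite scalerDr.
    by rewrite big_split /= -scaler_suml w1 scale1r [c + _]addrC addrK.
  elim/big_ind2: _ => [|? ? ? ? <- <-|ib _]; last 1 first.
  - by rewrite !fcoordZ fcoord_frame mulrA.
  - by rewrite -(scale0r 0) fcoordZ mul0r.
  - by rewrite fcoordD.
rewrite -w1.
under eq_bigr do rewrite cE.
apply: (@le_trans _ _ (\sum_l \sum_ib w ib * (ib.1 == l)%:R)).
  apply: ler_sum => l _; apply: le_trans (ler_norm_sum _ _ _) _.
  apply: ler_sum => ib _; rewrite !normrM normrX normrN1 expr1n mulr1.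
  by rewrite ger0_norm // normr_nat.
rewrite exchange_big /=; apply: ler_sum => ib _.
rewrite (bigD1 ib.1) //= eqxx mulr1 big1 ?addr0 // => l.
by rewrite eq_sym => /negPf ->; rewrite mulr0.
Qed.

End Regular.
End Frames.

(** * The boundary of one piece *)

Section Quarter.
Context {R : realType} (c : 'rV[R]_3) (e : 'I_3 -> 'rV[R]_3).
Hypothesis ereg : regular_half_diagonals e.

Definition quarter_vertex (i : 'I_4) : 'rV[R]_3 :=
  nth 0 [:: c + e x_axis; c - e x_axis; c + e y_axis; c + e z_axis] i.

(** The weights for which x is the combination of the quarter vertices with
    total weight 1. *)
Definition bary (i : 'I_4) (x : 'rV[R]_3) : R :=
  let a l := fcoord e l (x - c) in
  nth 0 [:: (1 + a x_axis - a y_axis - a z_axis) / 2;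
            (1 - a x_axis - a y_axis - a z_axis) / 2; a y_axis; a z_axis] i.

Definition frame_point (a b g : R) : 'rV[R]_3 :=
  c + (a *: e x_axis + b *: e y_axis + g *: e z_axis).

Lemma fcoord_point a b g l :
  fcoord e l (frame_point a b g - c) = nth 0 [:: a; b; g] l.
Proof.
rewrite /frame_point [c + _]addrC addrK !fcoordD !fcoordZ !(fcoord_frame ereg).
case: l => [[|[|[|//]]] l3] /=; rewrite /eq_op /=; ring.
Qed.

Lemma point_fcoord x : x = frame_point (fcoord e x_axis (x - c))
  (fcoord e y_axis (x - c)) (fcoord e z_axis (x - c)).
Proof.
have := fcoord_expansion ereg (x - c).
by rewrite sum_I3 /frame_point => <-; rewrite subrKC.
Qed.

Lemma bary_point a b g i : bary i (frame_point a b g) =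
  nth 0 [:: (1 + a - b - g) / 2; (1 - a - b - g) / 2; b; g] i.
Proof. by rewrite /bary !fcoord_point. Qed.

Lemma bary_affine i : affine (bary i).
Proof.
move=> t x y.
have aE l : fcoord e l ((1 - t) *: x + t *: y - c) =
    (1 - t) * fcoord e l (x - c) + t * fcoord e l (y - c).
  rewrite -!fcoordZ -fcoordD; congr fcoord.
  by apply/rowP => j; rewrite !mxE; ring.
by move: i; apply: forall_I4; rewrite /bary !aE /=; field.
Qed.

Lemma bary_combination (w : 'I_4 -> R) : \sum_i w i = 1 ->
  forall i, bary i (\sum_i w i *: quarter_vertex i) = w i.
Proof.
rewrite !sum_I4 /quarter_vertex /=; set w0 := w _; set w1 := w _.
set w2 := w _; set w3 := w _ => w1E.
rewrite (_ : w0 *: _ + _ + _ + _ = frame_point (w0 - w1) w2 w3); last first.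
  apply/rowP => j; rewrite !mxE.
  by rewrite (_ : w0 = 1 - w1 - w2 - w3); [ring | rewrite -w1E; ring].
apply: forall_I4; rewrite bary_point //= -/w0 -/w1; lra.
Qed.

Lemma combination_bary x :
  \sum_i bary i x = 1 /\ x = \sum_i bary i x *: quarter_vertex i.
Proof.
rewrite !sum_I4 /bary /quarter_vertex /=; split; first by field.
rewrite [LHS]point_fcoord; set a := fcoord _ x_axis _; set b := fcoord _ y_axis _.
by set g := fcoord _ _ _; apply/rowP => j; rewrite !mxE; field.
Qed.

Lemma quarter_hullE :
  convex_hull quarter_vertex = [set x | forall i, 0 <= bary i x].
Proof.
apply/seteqP; split=> [_ [w [w0 w1 ->]] i|x /= x0].
  by rewrite bary_combination.
by have [? ?] := combination_bary x; exists (bary^~ x).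
Qed.

Lemma bary_pos i : exists y, 0 < bary i y.
Proof.
exists (quarter_vertex i).
have -> : quarter_vertex i = \sum_j (j == i)%:R *: quarter_vertex j.
  rewrite (bigD1 i) //= eqxx scale1r big1 ?addr0 // => j /negPf ->.
  by rewrite scale0r.
rewrite bary_combination ?eqxx // (bigD1 i) //= eqxx big1 ?addr0 // => j.
by move=> /negPf ->.
Qed.

Lemma quarter_tetrahedron : tetrahedron (convex_hull quarter_vertex).
Proof.
exists quarter_vertex; split=> //; apply: inj_row_free => v.
rewrite mulmx_sum_row sum_I3 !rowK /quarter_vertex /= => v0.
(* The rows are the edge vectors from c + e_0. *)
have {}v0 l : fcoord e l (v 0 x_axis *: (-2 *: e x_axis) +
    v 0 y_axis *: (e y_axis - e x_axis) +
    v 0 z_axis *: (e z_axis - e x_axis)) = 0.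
  transitivity (fcoord e l 0); last by rewrite -(scale0r 0) fcoordZ mul0r.
  by rewrite -v0; congr fcoord; apply/rowP => j; rewrite !mxE; ring.
have := (v0 x_axis, v0 y_axis, v0 z_axis).
rewrite -!(scaleN1r (e x_axis)) !(fcoordD, fcoordZ) !(fcoord_frame ereg) /=.
rewrite /eq_op /= => -[[vx vy] vz].
apply/rowP => -[[|[|[|//]]] l3]; rewrite mxE.
- by rewrite (_ : Ordinal _ = x_axis); [lra | exact: val_inj].
- by rewrite (_ : Ordinal _ = y_axis); [lra | exact: val_inj].
- by rewrite (_ : Ordinal _ = z_axis); [lra | exact: val_inj].
Qed.

Lemma quarter_boundary : boundary (convex_hull quarter_vertex) =
  [set x | (forall i, 0 <= bary i x) /\ exists i, bary i x = 0].
Proof. by rewrite quarter_hullE boundary_polyhedron; [|exact: bary_affine|exact: bary_pos]. Qed.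

Lemma quarter_interior : interior (convex_hull quarter_vertex) =
  [set x | forall i, 0 < bary i x].
Proof. by rewrite quarter_hullE interior_polyhedron; [|exact: bary_affine|exact: bary_pos]. Qed.

Hypothesis axis_z : exists k, parallel_to k (e z_axis).
Hypothesis axis_diff : exists k, parallel_to k (e y_axis - e x_axis).
Hypothesis axis_sum : exists k, parallel_to k (e y_axis + e x_axis).

Let S := [set x | (forall i, 0 <= bary i x) /\ exists i, bary i x = 0].

Lemma boundary_slide j (t : R) v a b g a' b' g' : (exists k, parallel_to k v) ->
  frame_point a' b' g' = frame_point a b g + t *: v ->
  (forall i, 0 <= bary i (frame_point a b g)) -> bary j (frame_point a b g) = 0 ->
  (forall i, 0 <= bary i (frame_point a' b' g')) -> bary j (frame_point a' b' g') = 0 ->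
  axis_joined S (frame_point a b g) (frame_point a' b' g').
Proof.
move=> [k kv] -> s0 z0 s1 z1.
by apply: axis_joined_face kv s0 s1 z0 z1; exact: bary_affine.
Qed.

Local Ltac slide face t dir :=
  apply: (boundary_slide (j := Ordinal (isT : face < 4)%N) (t := t) dir);
  [ by apply/rowP => ?; rewrite !mxE; field
  | by apply: forall_I4; rewrite bary_point /=; lra
  | by rewrite bary_point /=; lra
  | by apply: forall_I4; rewrite bary_point /=; lra
  | by rewrite bary_point /=; lra ].

(** Along an L-shaped path in the bottom face: its corner is where the lines
    of directions e_1 - e_0 and e_1 + e_0 through the two ends meet. *)
Lemma diagonal_joined (a : R) : -1 <= a <= 1 ->
  axis_joined S (frame_point a 0 0) (frame_point 0 0 0).
Proof.
move=> a1; have [a0|a0] := lerP 0 a.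
  apply: (rst_trans _ _ _ (frame_point (a / 2) (a / 2) 0)).
    by slide 3%N (a / 2) axis_diff.
  by slide 3%N (- a / 2) axis_sum.
apply: (rst_trans _ _ _ (frame_point (a / 2) (- a / 2) 0)).
  by slide 3%N (- a / 2) axis_sum.
by slide 3%N (a / 2) axis_diff.
Qed.

(** In the face b = 0, the direction e_2 leads down to the common edge. *)
Lemma cut_face_joined (a g : R) : 0 <= g -> 0 <= 1 + a - g -> 0 <= 1 - a - g ->
  axis_joined S (frame_point a 0 g) (frame_point 0 0 0).
Proof.
move=> g0 ag1 ag2; apply: (rst_trans _ _ _ (frame_point a 0 0)).
  by slide 2%N (- g) axis_z.
by apply: diagonal_joined; lra.
Qed.

(** The faces are numbered by the barycentric coordinate that vanishes: 0 and 1
    are the outer ones, parallel to e_1 + e_0 and e_1 - e_0 respectively; 2 is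
    the face b = 0 and 3 the bottom g = 0. *)
Lemma quarter_boundary_connected :
  orthogonally_connected (boundary (convex_hull quarter_vertex)).
Proof.
rewrite quarter_boundary -/S.
apply: (@orthogonally_connected_hub _ _ (frame_point 0 0 0)) => x.
rewrite [x]point_fcoord; set a := fcoord _ _ _; set b := fcoord _ _ _.
set g := fcoord _ _ _ => -[pos [j]].
have := pos (Ordinal (isT : 0 < 4)%N); have := pos (Ordinal (isT : 1 < 4)%N).
have := pos (Ordinal (isT : 2 < 4)%N); have := pos (Ordinal (isT : 3 < 4)%N).
rewrite !bary_point /= => g0 b0 ag1 ag2.
move: j; apply: forall_I4; rewrite /= => z0.
- apply: (rst_trans _ _ _ (frame_point (a - b) 0 g)); last by apply: cut_face_joined; lra.
  by slide 0%N (- b) axis_sum.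
- apply: (rst_trans _ _ _ (frame_point (a + b) 0 g)); last by apply: cut_face_joined; lra.
  by slide 1%N (- b) axis_diff.
- by rewrite z0; apply: cut_face_joined; lra.
- apply: (rst_trans _ _ _ (frame_point (a + b) 0 g)); last by apply: cut_face_joined; lra.
  by slide 3%N (- b) axis_diff.
Qed.

End Quarter.

(** * Cutting the octahedron *)

(** The transposition makes the vertical half-diagonal d k the last vector of
    the frame; the two binary digits of q are the signs s and s' of the last two
    vectors. *)
Definition quarter_frame {R : realType} (d : 'I_3 -> 'rV[R]_3) (k : 'I_3)
    (q : 'I_4) (l : 'I_3) : 'rV[R]_3 :=
  (-1) ^+ nth false [:: false; odd q; (1 < q)%N] l *: d (tperm k z_axis l).

Section Cutting.
Context {R : realType} (c : 'rV[R]_3) (d : 'I_3 -> 'rV[R]_3) (k : 'I_3).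
Hypothesis dreg : regular_half_diagonals d.

Let e := quarter_frame d k.
Let T q := convex_hull (quarter_vertex c (e q)).

Lemma signs_index (s s' : bool) :
  exists q : 'I_4, odd q = s /\ (1 < q)%N = s'.
Proof.
case: s; case: s'.
- by exists (Ordinal (isT : 3 < 4)%N).
- by exists (Ordinal (isT : 1 < 4)%N).
- by exists (Ordinal (isT : 2 < 4)%N).
- by exists (Ordinal (isT : 0 < 4)%N).
Qed.

Lemma signs_inj (q q' : 'I_4) : odd q = odd q' -> (1 < q)%N = (1 < q')%N -> q = q'.
Proof. by case: q q' => [[|[|[|[|//]]]] ?] [[|[|[|[|//]]]] ?] //= _ _; exact: val_inj. Qed.

Lemma dot_frame q l l' : dot (e q l) (e q l') =
  (-1) ^+ nth false [:: false; odd q; (1 < q)%N] l *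
  (-1) ^+ nth false [:: false; odd q; (1 < q)%N] l' *
  dot (d (tperm k z_axis l)) (d (tperm k z_axis l')).
Proof. by rewrite /e /quarter_frame dotZl dotZr mulrA. Qed.

Lemma quarter_frame_regular q : regular_half_diagonals (e q).
Proof.
have [d0 dr od] := dreg; split=> [l|l l'|l l' ne].
- by rewrite scaler_eq0 signr_eq0 negb_or d0.
- by rewrite !dot_frame -!expr2 !sqrr_sign !mul1r.
- by rewrite dot_frame od ?mulr0 // (inj_eq perm_inj).
Qed.

Lemma fcoord_frame_sign q l x : fcoord (e q) l x =
  (-1) ^+ nth false [:: false; odd q; (1 < q)%N] l *
  fcoord d (tperm k z_axis l) x.
Proof.
rewrite /fcoord dot_frame -expr2 sqrr_sign mul1r /e /quarter_frame dotZr.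
by rewrite mulrA.
Qed.

Lemma quarter_sub_octahedron q : T q `<=` octahedron c d.
Proof.
pose g (i : 'I_4) : 'I_3 * bool :=
  nth (x_axis, false)
   [:: (tperm k z_axis x_axis, false); (tperm k z_axis x_axis, true);
       (tperm k z_axis y_axis, odd q); (tperm k z_axis z_axis, (1 < q)%N)] i.
rewrite /T /octahedron (_ : quarter_vertex c (e q) =
    (fun ib : 'I_3 * bool => c + (-1) ^+ ib.2 *: d ib.1) \o g).
  exact: convex_hull_comp.
apply/funext; apply: forall_I4; rewrite /quarter_vertex /e /quarter_frame /=;
  by rewrite ?expr0 ?expr1 ?scale1r ?scaleN1r.
Qed.

(** With the signs of the last two coordinates chosen as those of x, both become
    absolute values, and the two outer inequalities follow from the bound on the
    l1 norm. *)
Lemma octahedron_sub_quarters x : octahedron c d x -> exists q, T q x.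
Proof.
move=> /(octahedron_norm1 dreg).
rewrite (reindex_inj (@perm_inj _ (tperm k z_axis))) /= sum_I3.
set a := fcoord _ _ _; set b := fcoord _ _ _; set g := fcoord _ _ _ => abg.
have [q [sb sg]] := signs_index (b < 0) (g < 0).
exists q; rewrite /T quarter_hullE; last exact: quarter_frame_regular.
apply: forall_I4; rewrite /bary !fcoord_frame_sign /= -?/a -?/b -?/g ?sb ?sg
  -?normrEsign ?expr0 ?mul1r.
- by have := ler_norm (- a); rewrite normrN; lra.
- by have := ler_norm a; lra.
- exact: normr_ge0.
- exact: normr_ge0.
Qed.

(** The sign of the coordinate of an interior point along d_j or d_k determines
    the corresponding sign of the piece. *)
Lemma quarters_disjoint q q' : q != q' -> interior (T q) `&` interior (T q') = set0.
Proof.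
move=> ne; apply/seteqP; split=> // x [].
rewrite !quarter_interior; [|exact: quarter_frame_regular..] => px px'.
have := px (Ordinal (isT : 2 < 4)%N); have := px' (Ordinal (isT : 2 < 4)%N).
have := px (Ordinal (isT : 3 < 4)%N); have := px' (Ordinal (isT : 3 < 4)%N).
rewrite /bary /= !fcoord_frame_sign /=.
set b := fcoord _ _ _; set g := fcoord _ _ _ => g' g0 b' b0.
have same (s s' : bool) (t : R) : 0 < (-1) ^+ s * t -> 0 < (-1) ^+ s' * t -> s = s'.
  by case: s; case: s'; rewrite ?expr1 ?expr0 //; lra.
by move/eqP: ne; apply; apply: signs_inj; [exact: same b0 b' | exact: same g0 g'].
Qed.

Lemma quarters_decompose : decomposed_into (octahedron c d) T.
Proof.
split; last exact: quarters_disjoint.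
apply/seteqP; split=> [x /octahedron_sub_quarters [q Tx]|x [q _]].
  by exists q.
exact: quarter_sub_octahedron.
Qed.

End Cutting.

(** * The decomposition *)

Theorem theorem4p1 (R : realType) (c : 'rV[R]_3) (d : 'I_3 -> 'rV[R]_3)
    (hreg : regular_half_diagonals d) (hstd : standard_position d) :
  exists T : 'I_4 -> set 'rV[R]_3,
    [/\ forall i, tetrahedron (T i),
        decomposed_into (octahedron c d) T &
        forall i, orthogonally_connected (boundary (T i))].
Proof.
have [k [dk sides]] := hstd.
have ereg q := quarter_frame_regular k hreg q.
exists (fun q => convex_hull (quarter_vertex c (quarter_frame d k q))); split.
- by move=> q; exact: quarter_tetrahedron.
- exact: quarters_decompose.
(* The vectors e_1 - e_0 (s = false) and e_1 + e_0 (s = true) are sides of the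
   square, whichever sign d_j has in e_1. *)
have side q (s : bool) : exists i, parallel_to i
    (quarter_frame d k q y_axis - (-1) ^+ s *: quarter_frame d k q x_axis).
  rewrite /quarter_frame /= expr0 scale1r.
  have ne l : l != z_axis -> tperm k z_axis l != k.
    by rewrite -[X in _ -> _ != X](tpermR k z_axis) (inj_eq perm_inj).
  have [] := sides (tperm k z_axis x_axis) (tperm k z_axis y_axis) _ _ _ (odd q) s.
  - exact: ne.
  - exact: ne.
  - by rewrite (inj_eq perm_inj).
  - by exists x_axis.
  - by exists y_axis.
move=> q; apply: quarter_boundary_connected => //.
- exists z_axis; rewrite /quarter_frame /= tpermR.
  case: dk => t t0 ->; exists ((-1) ^+ (1 < q)%N * t); last by rewrite scalerA.
  by rewrite mulf_neq0 ?signr_eq0.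
- by have := side q false; rewrite expr0 scale1r.
- by have := side q true; rewrite expr1 scaleN1r opprK.
Qed.
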